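(* Let $k,p,s,r$ be positive real numbers, $n\in\mathbb{N}$, $n\ge1$, and $x\in\mathbb{C}\setminus k\mathbb{Z}^{-}$ with $\mathrm{Re}(x)>0$. Then the following identities hold: $$ {}_{p}(x)_{n,s}={}_{p}\left(\tfrac{kx}{s}\right)_{n,k},$$ $$ {}_{p}(x)_{n,s}=\left(\tfrac{p}{s}\right)^{n}\,{}_{s}\left(\tfrac{kx}{s}\right)_{n,k},$$ $$ {}_{p}(x)_{n,k}=\left(\tfrac{p}{s}\right)^{n}\,{}_{s}(x)_{n,k},$$ $$ {}_{p}\Gamma_{s}(x)=\tfrac{k}{s}\;{}_{p}\Gamma_{k}\left(\tfrac{kx}{s}\right),$$ $$ {}_{r}\Gamma_{s}(x)=\tfrac{k}{s}\left(\tfrac{r}{p}\right)^{\frac{x}{s}}{}_{p}\Gamma_{k}\left(\tfrac{kx}{s}\right),$$ $$ {}_{r}\Gamma_{k}(x)=\left(\tfrac{r}{p}\right)^{\frac{x}{k}}{}_{p}\Gamma_{k}(x).$$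
   Context: $\mathbb{Z}^-$ is the set of negative integers. For positive reals $p,k$ (and likewise with other positive real subscripts) the p-k Pochhammer symbol is ${}_{p}(x)_{n,k}=\left(\frac{xp}{k}\right)\left(\frac{xp}{k}+p\right)\cdots\left(\frac{xp}{k}+(n-1)p\right)$, and the p-k Gamma function is, for $\mathrm{Re}(x)>0$, $${}_{p}\Gamma_{k}(x)=\frac1k\lim_{n\to\infty}\frac{n!\,p^{n+1}(np)^{x/k}}{{}_{p}(x)_{n+1,k}}=\frac1k\lim_{n\to\infty}\frac{n!\,p^{n+1}(np)^{\frac{x}{k}-1}}{{}_{p}(x)_{n,k}}.$$ For a positive real base $c$, $c^{z}=e^{z\ln c}$. *)

(* Defs.v *)
From HB Require Import structures.
From mathcomp Require Import all_boot all_order all_algebra.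
From mathcomp Require Import complex.
From mathcomp Require Import all_classical all_reals all_analysis.

Set Implicit Arguments.
Unset Strict Implicit.
Unset Printing Implicit Defensive.

Import Order.TTheory GRing.Theory Num.Theory.
Import numFieldNormedType.Exports.

Local Open Scope classical_set_scope.
Local Open Scope ring_scope.
Local Open Scope complex_scope.

Definition cexp {R : realType} (z : R[i]) : R[i] :=
  (expR (complex.Re z))%:C *
  (cos (complex.Im z) +i* sin (complex.Im z)).

(* Only meaningful for c > 0; for c = 0, [ln 0 = 0] gives the value 1, which
   below only affects the term of index 0 of a sequence. *)
Definition cpow {R : realType} (c : R) (z : R[i]) : R[i] :=
  cexp (z * (ln c)%:C).

Definition pk_pochhammer {R : realType} (p k : R) (n : nat) (x : R[i]) : R[i] :=
  \prod_(i < n) (x * p%:C / k%:C + (i%:R * p)%:C).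

Definition pk_gamma_seq {R : realType} (p k : R) (x : R[i]) (n : nat) : R[i] :=
  (n`!%:R * p ^+ n.+1)%:C * cpow (n%:R * p) (x / k%:C)
  / pk_pochhammer p k n.+1 x.

(* The alias [R[i]^o] selects the norm topology of the complex numbers.
   The limit exists for Re x > 0, and is the same for the sequence
   n! p^(n+1) (np)^(x/k-1) / pk_pochhammer p k n x, since the ratio of the two
   sequences is np / (xp/k + np), which tends to 1. *)
Definition pk_gamma {R : realType} (p k : R) (x : R[i]) : R[i] :=
  k%:C^-1 * lim ((pk_gamma_seq p k x : nat -> R[i]^o) @ \oo).

(* Main.v *)
(* Both families of symbols depend on [x] and the second subscript only through
   [x / k], and rescaling the first subscript by [r / p] pulls a constant out of
   each Pochhammer factor and out of [(n p)^(x / k)]. The Gamma identities follow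
   because [lim] commutes with nonzero scalars. That holds without convergence,
   since here the limit of a divergent sequence is by convention [0]. *)
Require Import Defs.
From HB Require Import structures.
From mathcomp Require Import all_boot all_order all_algebra.
From mathcomp Require Import complex.
From mathcomp Require Import all_classical all_reals all_analysis.

Import Order.TTheory GRing.Theory Num.Theory.
Import numFieldNormedType.Exports.

Local Open Scope classical_set_scope.
Local Open Scope ring_scope.
Local Open Scope complex_scope.

(** Equality is asked only for large [n], so that an exceptional initial term can be ignored. *)
Lemma cvgn_near_scale (K : numFieldType) (V : normedModType K)
    (c : K) (u v : nat -> V) (l : V) :
  (\forall n \near \oo, v n = c *: u n) ->
  (u n @[n --> \oo] --> l) -> (v n @[n --> \oo] --> c *: l).
Proof.
move=> vE ul; apply: (cvg_trans _ (cvgZ (cvg_cst c) ul)).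
by apply: near_eq_cvg; apply: filterS vE => n ->.
Qed.

Lemma limn_near_scale (R : realType) (c : R[i]) (u v : nat -> R[i]^o) :
  c != 0 -> (\forall n \near \oo, v n = c * u n) ->
  lim (v @ \oo) = c * lim (u @ \oo) :> R[i].
Proof.
move=> c0 vE; have [cu|du] := pselect (cvg (u @ \oo)).
  exact: (cvg_lim (@norm_hausdorff _ R[i]^o)
    (@cvgn_near_scale _ R[i]^o c u v _ vE cu)).
(* Both limits take the default value 0, provided that [v] diverges as well. *)
rewrite (dvgP du) dvgP; first by rewrite [RHS]mulr0.
(* Since [c] is invertible, a limit of [v] would yield one of [u], eventually equal to
   [c^-1 * v]. *)
move=> cv; apply: du; apply/cvg_ex; exists (c^-1 *: (lim (v @ \oo) : R[i]^o)).
apply: (@cvgn_near_scale _ R[i]^o c^-1 v u _ _ cv).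
by apply: filterS vE => n ->; rewrite [RHS]mulKf.
Qed.

Lemma cexpD (R : realType) (z w : R[i]) : cexp (z + w) = cexp z * cexp w.
Proof.
case: z w => [a b] [c d]; rewrite /cexp /= expRD rmorphM /= cosD sinD mulrACA.
by congr (_ * _); apply/eqP; rewrite eq_complex /= (addrC (cos b * sin d)) !eqxx.
Qed.

(** [cexp (- z)] is an inverse. *)
Lemma cexp_neq0 (R : realType) (z : R[i]) : cexp z != 0.
Proof.
have e : cexp z * cexp (- z) = 1.
  by rewrite -cexpD subrr /cexp /= expR0 cos0 sin0 mul1r.
by apply: contra_eq_neq e => ->; rewrite mul0r eq_sym oner_eq0.
Qed.

Lemma cpowM (R : realType) (a b : R) (z : R[i]) :
  0 < a -> 0 < b -> cpow (a * b) z = cpow a z * cpow b z.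
Proof. by move=> a0 b0; rewrite /cpow lnM ?posrE// rmorphD mulrDr cexpD. Qed.

Lemma pk_pochhammer_change_k (R : realType) (p k s : R) n (x : R[i]) :
  k != 0 -> pk_pochhammer p s n x = pk_pochhammer p k n (k%:C * x / s%:C).
Proof.
move=> k0; apply: eq_bigr => i _; congr (_ + _).
have kC0 : k%:C != 0 by rewrite fmorph_eq0.
by rewrite -!mulrA [RHS]mulrC -!mulrA mulVf// mulr1 (mulrC s%:C^-1).
Qed.

(** Each of the [n] factors is homogeneous of degree one in [p]. *)
Lemma pk_pochhammer_change_p (R : realType) (p k s : R) n (x : R[i]) :
  s != 0 -> pk_pochhammer p k n x = (p / s)%:C ^+ n * pk_pochhammer s k n x.
Proof.
move=> s0; rewrite /pk_pochhammer -[in _ ^+ n](card_ord n) -prodr_const.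
rewrite -big_split /=; apply: eq_bigr => i _; rewrite mulrDr -rmorphM /=.
have -> : p / s * (i%:R * s) = i%:R * p by rewrite mulrCA divfK.
congr (_ + _); rewrite -[in LHS](divfK s0 p) rmorphM /=.
by rewrite !mulrA (mulrC x).
Qed.

Lemma pk_gamma_change_k (R : realType) (p k s : R) (x : R[i]) :
  k != 0 -> pk_gamma p s x = (k / s)%:C * pk_gamma p k (k%:C * x / s%:C).
Proof.
move=> k0; have kC0 : k%:C != 0 by rewrite fmorph_eq0.
(* The two sequences agree term by term; only the prefactors [1/s] and [1/k] differ, and the factor
   [k] cancels the latter. *)
have -> : pk_gamma p s x = s%:C^-1 * (k%:C * pk_gamma p k (k%:C * x / s%:C)).
  have seqE : pk_gamma_seq p s x = pk_gamma_seq p k (k%:C * x / s%:C).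
    apply/funext => n; rewrite /pk_gamma_seq -pk_pochhammer_change_k//.
    by rewrite (mulrAC _ s%:C^-1) (mulrC k%:C) mulfK.
  by rewrite /pk_gamma mulVKf// seqE.
by rewrite mulrA rmorphM fmorphV /= (mulrC s%:C^-1).
Qed.

Lemma pk_gamma_change_p (R : realType) (p k r : R) (x : R[i]) :
  0 < p -> 0 < r -> pk_gamma r k x = cpow (r / p) (x / k%:C) * pk_gamma p k x.
Proof.
move=> p0 r0; rewrite /pk_gamma mulrCA; congr (_ * _).
apply: limn_near_scale; first exact: cexp_neq0.
(* The term of index 0 contains the junk value [ln 0]. *)
exists 1%N => // n /= n0.
rewrite /pk_gamma_seq (@pk_pochhammer_change_p _ r k p) ?gt_eqF//.
have -> : n%:R * r = (r / p) * (n%:R * p) by rewrite mulrCA divfK ?gt_eqF.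
rewrite cpowM ?divr_gt0 ?mulr_gt0 ?ltr0n//.
have -> : n`!%:R * r ^+ n.+1 = (r / p) ^+ n.+1 * (n`!%:R * p ^+ n.+1).
  by rewrite expr_div_n mulrCA divfK // expf_neq0 ?gt_eqF.
have rpC0 : (r / p)%:C ^+ n.+1 != 0.
  by rewrite expf_neq0 // fmorph_eq0 mulf_neq0 ?invr_eq0 ?gt_eqF.
(* The power [(r / p) ^+ n.+1] from the numerator cancels the one from the Pochhammer symbol, so the
   remaining ratio is independent of [n]. *)
rewrite [X in X * (_ * _) / _]rmorphM rmorphXn -[_ * _ * (_ * _)]mulrA.
by rewrite -mulf_div mulfV// mul1r mulrCA !mulrA.
Qed.

Theorem theorem2p3 (R : realType) (k p s r : R) (n : nat) (x : R[i])
    (k_gt0 : 0 < k) (p_gt0 : 0 < p) (s_gt0 : 0 < s) (r_gt0 : 0 < r)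
    (n_ge1 : (1 <= n)%N)
    (x_notin : forall m : int, m < 0 -> x <> k%:C * m%:~R)
    (Re_x_gt0 : 0 < complex.Re x) :
  pk_pochhammer p s n x = pk_pochhammer p k n (k%:C * x / s%:C) /\
  pk_pochhammer p s n x =
    (p / s)%:C ^+ n * pk_pochhammer s k n (k%:C * x / s%:C) /\
  pk_pochhammer p k n x = (p / s)%:C ^+ n * pk_pochhammer s k n x /\
  pk_gamma p s x = (k / s)%:C * pk_gamma p k (k%:C * x / s%:C) /\
  pk_gamma r s x =
    (k / s)%:C * cpow (r / p) (x / s%:C) * pk_gamma p k (k%:C * x / s%:C) /\
  pk_gamma r k x = cpow (r / p) (x / k%:C) * pk_gamma p k x.
Proof.
have k0 : k != 0 by rewrite gt_eqF.
have s0 : s != 0 by rewrite gt_eqF.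
split; first exact: pk_pochhammer_change_k.
split; first by rewrite -pk_pochhammer_change_p// -pk_pochhammer_change_k.
split; first exact: pk_pochhammer_change_p.
split; first exact: pk_gamma_change_k.
split; last exact: pk_gamma_change_p.
have kC0 : k%:C != 0 by rewrite fmorph_eq0.
(* Passing from [s] to [k] first gives the power of [r / p] the exponent [(k x / s) / k], which
   reduces to [x / s]. *)
rewrite (@pk_gamma_change_k _ r k s)// (@pk_gamma_change_p _ p k r)// mulrA.
by rewrite (mulrAC _ s%:C^-1) (mulrC k%:C x) mulfK.
Qed.
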